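(* Let $A$ and $B$ be two subspaces of $R^n$. If $\dim(A+B)=\dim(A)+\dim(B)-\dim(A\cap B)$, then $$(A\cap B)^{\perp}=A^{\perp}+B^{\perp}\quad\text{and}\quad (A+B)^{\perp}=A^{\perp}\cap B^{\perp}.$$
   Context: $R$ is a finite commutative ring with identity $1\neq 0$. $R^n$ denotes the free module of row vectors of length $n$ over $R$. A set $\{\alpha_1,\dots,\alpha_m\}\subseteq R^n$ is unimodular if the $m\times n$ matrix with rows $\alpha_1,\dots,\alpha_m$ has a right inverse in $R^{n\times m}$. A linear subset of $R^n$ is an $R$-submodule; its dimension $\dim(V)$ is the maximum number of vectors in a unimodular subset of $V$. An $m$-subspace of $R^n$ is an $R$-submodule having a basis of $m$ vectors which form a unimodular set; the $0$-subspace is $\{0\}$. $A+B=\{a+b:a\in A,b\in B\}$. For a linear subset $A$, $A^{\perp}=\{y\in R^n: yx^{\top}=0 \text{ for all } x\in A\}$. *)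

(* Defs.v *)
From HB Require Import structures.
From mathcomp Require Import all_boot all_order all_algebra.

Set Implicit Arguments.
Unset Strict Implicit.
Unset Printing Implicit Defensive.

Import GRing.Theory.
Local Open Scope ring_scope.

Section RowModule.
Variables (R : finComNzRingType) (n : nat).
Implicit Types (S V A B : {set 'rV[R]_n}).

(* The rows are the elements of S in the order of enum S; neither existence of
   a right inverse nor being a basis depends on the order chosen. *)
Definition rows_mx S : 'M[R]_(#|S|, n) := \matrix_(i < #|S|) enum_val i.

Definition unimodular S : bool :=
  [exists N : 'M[R]_(n, #|S|), rows_mx S *m N == 1%:M].

Definition dimension V : nat :=
  \max_(S : {set 'rV[R]_n} | (S \subset V) && unimodular S) #|S|.

Definition linearly_independent S : Prop :=
  forall c : 'rV[R]_#|S|, c *m rows_mx S = 0 -> c = 0.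

Definition linear_span S : {set 'rV[R]_n} :=
  [set c *m rows_mx S | c : 'rV[R]_#|S|].

Definition is_basis S V : Prop :=
  linearly_independent S /\ linear_span S = V.

Definition is_m_subspace (m : nat) V : Prop :=
  submod_closed V /\
  exists S, [/\ #|S| = m, is_basis S V & unimodular S].

Definition is_subspace V : Prop := exists m : nat, is_m_subspace m V.

Definition sum_set A B : {set 'rV[R]_n} := [set a + b | a in A, b in B].

Definition perp A : {set 'rV[R]_n} :=
  [set y | [forall x in A, y *m x^T == 0]].

End RowModule.

(* Main.v *)
(** Let M be the matrix stacking bases of A and B, with a + b rows.  A maximal
    unimodular set C in the intersection gives c relations K between the rows
    of M, and K has a right inverse because C does.  A maximal unimodular set
    U = Z M in the sum gives, by the hypothesis on dimensions, a square matrix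
    with blocks K and Z; it is right invertible, hence invertible.  So a column
    vector g killed by K is of the form M f: a functional vanishing on C
    can thus be split into one vanishing on A and one vanishing on B. *)

Require Import Defs.
From HB Require Import structures.
From mathcomp Require Import all_boot all_order all_algebra.

Set Implicit Arguments.
Unset Strict Implicit.
Unset Printing Implicit Defensive.

Import GRing.Theory.
Local Open Scope ring_scope.

(** Needed for a stacked matrix with [c + d] rows and [m] columns, two sizes that are equal but not
    convertible. *)
Lemma mulmx1C_cast (R : comNzRingType) (m k : nat) (A : 'M[R]_(m, k))
    (B : 'M[R]_(k, m)) : m = k -> A *m B = 1%:M -> B *m A = 1%:M.
Proof. by move=> eq_mk; subst k; exact: mulmx1C. Qed.

Lemma solvable_of_relations (R : comNzRingType) (n m c d : nat)
    (M : 'M[R]_(m, n)) (K : 'M[R]_(c, m)) (K' : 'M[R]_(m, c))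
    (Z : 'M[R]_(d, m)) (N : 'M[R]_(n, d)) (g : 'cV[R]_m) :
    (c + d)%N = m -> K *m M = 0 -> K *m K' = 1%:M -> Z *m M *m N = 1%:M ->
  K *m g = 0 -> exists f : 'cV[R]_n, M *m f = g.
Proof.
move=> cdm KM KK' ZMN Kg.
(* Since [K M = 0], the correction to [K'] leaves its product with [K] equal to 1; since
   [Z M N = 1], it makes the product with [Z] vanish. *)
pose V := row_mx (K' - M *m N *m Z *m K') (M *m N).
have WV : col_mx K Z *m V = 1%:M.
  rewrite /V mul_col_row !mulmxBr !mulmxA KM KK' ZMN !mul0mx mul1mx subr0 subrr.
  by rewrite -scalar_mx_block.
have VW := mulmx1C_cast cdm WV.
(* Multiplying [g] by the stacked matrix gives [K g = 0] above [Z g]; applying [V] then leaves only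
   [M N (Z g)]. *)
exists (N *m (Z *m g)).
rewrite -[RHS]mul1mx -VW -mulmxA mul_col_mx Kg mul_row_col mulmx0 add0r.
by rewrite !mulmxA.
Qed.

Section RowModuleTheory.
Variables (R : finComNzRingType) (n : nat).
Implicit Types (S T V A B : {set 'rV[R]_n}) (x y : 'rV[R]_n).

Lemma unimodularP S :
  reflect (exists N, rows_mx S *m N = 1%:M) (unimodular S).
Proof. exact: 'exists_eqP. Qed.

Lemma row_rows_mx S (i : 'I_#|S|) : row i (rows_mx S) = enum_val i.
Proof. exact: rowK. Qed.

Lemma rows_mx_factor S (m : nat) (M : 'M[R]_(m, n)) :
    (forall x, x \in S -> exists c : 'rV_m, x = c *m M) ->
  exists P, rows_mx S = P *m M.
Proof.
move=> SM.
have /fin_all_exists[f fP] (i : 'I_#|S|) :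
  exists c : 'rV_m, enum_val i = c *m M by exact/SM/enum_valP.
exists (\matrix_i f i); apply/row_matrixP => i.
by rewrite row_rows_mx row_mul rowK -fP.
Qed.

Lemma linear_spanP S x :
  reflect (exists c, x = c *m rows_mx S) (x \in linear_span S).
Proof.
by apply: (iffP imsetP) => [[c _ ->]|[c ->]]; exists c.
Qed.

Lemma mem_linear_span S x : x \in S -> x \in linear_span S.
Proof.
move=> Sx; apply/linear_spanP; exists (delta_mx 0 (enum_rank_in Sx x)).
by rewrite -rowE row_rows_mx enum_rankK_in.
Qed.

Lemma dimension_attained V :
  exists S, [/\ S \subset V, unimodular S & #|S| = dimension V].
Proof.
(* The empty set makes the family of the maximum nonempty; its right inverse condition is an
   equation between matrices with no entries. *)
have P0 : (set0 \subset V) && unimodular (set0 : {set 'rV[R]_n}).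
  rewrite sub0set; apply/unimodularP; exists 0; apply/matrixP => i.
  by have := enum_valP i; rewrite inE.
pose P := [pred S : {set 'rV[R]_n} | (S \subset V) && unimodular S].
have [|S /andP[SV uS] eqS] := @eq_bigmax_cond _ P (fun S => #|S|).
  by apply/card_gt0P; exists set0.
by exists S; rewrite /dimension eqS.
Qed.

Lemma leq_dimension S V :
  S \subset V -> unimodular S -> (#|S| <= dimension V)%N.
Proof.
move=> SV uS; apply: (leq_bigmax_cond (F := fun T : {set _} => #|T|)).
by rewrite SV.
Qed.

(** The rows of a unimodular [T] in the span factor through those of [S], so the identity of size
    [#|T|] factors through size [#|S|]; over a nonzero commutative ring this forces
    [#|T| <= #|S|]. *)
Lemma dimension_linear_span S : unimodular S -> dimension (linear_span S) = #|S|.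
Proof.
move=> uS; apply/eqP; rewrite eqn_leq; apply/andP; split; last first.
  by apply: leq_dimension uS; apply/subsetP => x; exact: mem_linear_span.
apply/bigmax_leqP => T /andP[/subsetP TS /unimodularP[N TN]].
have [x /TS/linear_spanP//|P TP] := @rows_mx_factor T _ (rows_mx S).
by move: TN; rewrite TP -mulmxA; exact: mulmx1_min.
Qed.

Lemma dimensionS A B : A \subset B -> (dimension A <= dimension B)%N.
Proof.
move=> AB; apply/bigmax_leqP => T /andP[TA uT].
exact: leq_dimension (subset_trans TA AB) uT.
Qed.

Lemma perpP A y :
  reflect (forall x, x \in A -> y *m x^T = 0) (y \in perp A).
Proof. by rewrite inE; apply: (iffP forall_inP) => yA x /yA /eqP. Qed.

Lemma perpS A B : A \subset B -> perp B \subset perp A.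
Proof.
move=> /subsetP AB; apply/subsetP => y /perpP yB.
by apply/perpP => x /AB /yB.
Qed.

Lemma perpD A x y : x \in perp A -> y \in perp A -> x + y \in perp A.
Proof.
move=> /perpP xA /perpP yA; apply/perpP => z zA.
by rewrite mulmxDl xA // yA // addr0.
Qed.

Lemma mem_perp_rows S y : (y \in perp S) = (rows_mx S *m y^T == 0).
Proof.
apply/perpP/eqP => [yS|Sy x Sx].
  apply/row_matrixP => i; rewrite row_mul row_rows_mx row0.
  by apply: trmx_inj; rewrite trmx_mul trmxK trmx0 yS ?enum_valP.
apply: trmx_inj; rewrite trmx_mul trmxK trmx0 -[x](enum_rankK_in Sx Sx).
by rewrite -row_rows_mx -row_mul Sy row0.
Qed.

Lemma perp_linear_span S : perp (linear_span S) = perp S.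
Proof.
apply/eqP; rewrite eqEsubset; apply/andP; split.
  by apply/perpS/subsetP => x; exact: mem_linear_span.
apply/subsetP => y; rewrite mem_perp_rows => /eqP Sy.
apply/perpP => x /linear_spanP[c ->].
by apply: trmx_inj; rewrite trmx_mul trmxK trmx0 -mulmxA Sy mulmx0.
Qed.

Lemma perp_sum A B : 0 \in A -> 0 \in B ->
  perp (sum_set A B) = perp A :&: perp B.
Proof.
move=> A0 B0; apply/setP => y; rewrite in_setI; apply/idP/andP.
  move=> yAB; split; apply: (subsetP (perpS _)) yAB; apply/subsetP => x xA.
    by rewrite -[x]addr0; exact: imset2_f.
  by rewrite -[x]add0r; exact: imset2_f.
move=> [/perpP yA /perpP yB]; apply/perpP => _ /imset2P[a b aA bB ->].
by rewrite linearD mulmxDr yA // yB // addr0.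
Qed.

Lemma sum_perp_sub A B : sum_set (perp A) (perp B) \subset perp (A :&: B).
Proof.
apply/subsetP => _ /imset2P[y z yA zB ->].
by apply: perpD; [apply: subsetP yA | apply: subsetP zB];
  rewrite perpS ?subsetIl ?subsetIr.
Qed.

Lemma perpI_linear_span S T :
    unimodular S ->
    let A := linear_span S in let B := linear_span T in
    dimension (sum_set A B) = (#|S| + #|T| - dimension (A :&: B))%N ->
  perp (A :&: B) \subset sum_set (perp A) (perp B).
Proof.
move=> uS A B dAB; apply/subsetP => y yAB.
have [C [CAB /unimodularP[NC CNC] cC]] := dimension_attained (A :&: B).
have [U [/subsetP UAB /unimodularP[N UN] cU]] := dimension_attained (sum_set A B).
(* Each vector of [C] is expanded both in [S] and in [T]; the difference of the two expansions is a
   relation, a row of [(P, -Q)]. *)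
have [x /(subsetP CAB)/setIP[/linear_spanP//]|P CP] :=
  @rows_mx_factor C _ (rows_mx S).
have [x /(subsetP CAB)/setIP[_ /linear_spanP//]|Q CQ] :=
  @rows_mx_factor C _ (rows_mx T).
have [|Z UZ] := @rows_mx_factor U _ (col_mx (rows_mx S) (rows_mx T)).
  move=> _ /UAB/imset2P[_ _ /linear_spanP[p ->] /linear_spanP[q ->] ->].
  by exists (row_mx p q); rewrite mul_row_col.
have cdm : (#|C| + #|U|)%N = (#|S| + #|T|)%N.
  (* The truncated subtraction is exact because the dimension of [A :&: B] is at most
     [dimension A = #|S|]. *)
  rewrite cU dAB cC subnKC // (leq_trans _ (leq_addr _ _)) //.
  by rewrite -(dimension_linear_span uS) dimensionS // subsetIl.
have Cy : rows_mx C *m y^T = 0.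
  by apply/eqP; rewrite -mem_perp_rows (subsetP (perpS CAB)).
(* The column [g] prescribes the values of [f]: zero on [S], those of [y] on [T]. The relations kill
   [g] because [y] is orthogonal to [C]. *)
have [||||f] := solvable_of_relations (K := row_mx P (- Q))
    (M := col_mx (rows_mx S) (rows_mx T)) (K' := col_mx (rows_mx S *m NC) 0)
    (Z := Z) (N := N) (g := col_mx 0 (rows_mx T *m y^T)) cdm.
- by rewrite mul_row_col mulNmx -CP -CQ subrr.
- by rewrite mul_row_col mulmx0 addr0 mulmxA -CP.
- by rewrite -UZ.
- by rewrite mul_row_col mulmx0 add0r mulNmx mulmxA -CQ Cy oppr0.
rewrite mul_col_mx => /eq_col_mx[Sf Tf].
(* As [f] vanishes on [S] and agrees with [y] on [T], the two summands lie in [perp A] and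
   [perp B]. *)
apply/imset2P; exists f^T (y - f^T); last by rewrite addrC subrK.
  by rewrite perp_linear_span mem_perp_rows trmxK Sf.
by rewrite perp_linear_span mem_perp_rows linearB /= trmxK mulmxBr Tf subrr.
Qed.

End RowModuleTheory.

Local Close Scope ring_scope.

Theorem theorem4p6 (R : finComNzRingType) (n : nat) (A B : {set 'rV[R]_n})
    (hA : is_subspace A) (hB : is_subspace B)
    (hdim : dimension (sum_set A B) =
            (dimension A + dimension B - dimension (A :&: B))%N) :
  perp (A :&: B) = sum_set (perp A) (perp B) /\
  perp (sum_set A B) = perp A :&: perp B.
Proof.
have [a [[A0 _] [S [_ [_ spanS] uS]]]] := hA.
have [b [[B0 _] [T [_ [_ spanT] uT]]]] := hB.
split; last exact: perp_sum.
(* The dimension hypothesis enters in the remaining inclusion, with [dimension A] and [dimension B]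
   read as sizes of unimodular bases. *)
apply/eqP; rewrite eqEsubset sum_perp_sub andbT; subst A B.
by apply: perpI_linear_span => //; rewrite hdim !dimension_linear_span.
Qed.
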